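(* Let $\nu$ be an infinite cardinal with $\nu=\nu^{<\nu}$ and let $\kappa=\nu^+=2^\nu$. Assume that every $\kappa$-Aronszajn tree that does not contain a $\kappa$-Souslin subtree is special. Then there is a $\mathbf{\Delta}^1_1$-subset of ${}^\kappa\kappa$ that does not have the $\kappa$-Baire property.
   Context: ${}^\kappa\kappa$ is the set of functions $\kappa\to\kappa$, with the topology whose basic open sets are $N_s=\{x\in{}^\kappa\kappa : s\subseteq x\}$ for $s$ a function from some ordinal $\alpha<\kappa$ to $\kappa$. A subset of ${}^\kappa\kappa$ is $\mathbf{\Sigma}^1_1$ if it is the projection onto the first coordinate of a closed subset of ${}^\kappa\kappa\times{}^\kappa\kappa$, and $\mathbf{\Delta}^1_1$ if both it and its complement are $\mathbf{\Sigma}^1_1$. A set $A\subseteq{}^\kappa\kappa$ has the $\kappa$-Baire property if there are an open $U$ and nowhere dense sets $N_\alpha$ ($\alpha<\kappa$) with the symmetric difference of $A$ and $U$ contained in $\bigcup_{\alpha<\kappa}N_\alpha$. A $\kappa$-Aronszajn tree is a tree of height $\kappa$ with no branch of length $\kappa$ all of whose levels have cardinality less than $\kappa$; it is a $\kappa$-Souslin tree if moreover all its antichains have cardinality less than $\kappa$. A tree $T$ of height $\nu^+$ is special if there is a function $s:T\to\nu$ that is injective on chains of $T$. *)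

(* Defs.v *)
(* Cardinals are represented by well-ordered types that are
   initial ordinals; subsets are predicates; cardinal comparison is via
   injections/bijections. *)
From Stdlib Require Import Classical.



Definition injective {A B : Type} (f : A -> B) : Prop :=
  forall x y, f x = f y -> x = y.

Definition bijective {A B : Type} (f : A -> B) : Prop :=
  injective f /\ forall y, exists x, f x = y.

Definition inj_le (A B : Type) : Prop := exists f : A -> B, injective f.

Definition equipotent (A B : Type) : Prop := exists f : A -> B, bijective f.

Definition well_order {A : Type} (lt : A -> A -> Prop) : Prop :=
  (forall x, ~ lt x x) /\
  (forall x y z, lt x y -> lt y z -> lt x z) /\
  (forall x y, lt x y \/ x = y \/ lt y x) /\
  well_founded lt.

Definition seg {A : Type} (lt : A -> A -> Prop) (a : A) : Type :=
  { x : A | lt x a }.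

Definition is_cardinal {A : Type} (lt : A -> A -> Prop) : Prop :=
  well_order lt /\ forall a : A, ~ inj_le A (seg lt a).

Definition infinite_cardinal {A : Type} (lt : A -> A -> Prop) : Prop :=
  is_cardinal lt /\ inj_le nat A.

Definition successor_cardinal_of {N K : Type}
  (ltN : N -> N -> Prop) (ltK : K -> K -> Prop) : Prop :=
  is_cardinal ltK /\ inj_le N K /\ ~ inj_le K N /\
  forall a : K, inj_le (seg ltK a) N.

Definition order_iso {A B : Type} (ltA : A -> A -> Prop) (ltB : B -> B -> Prop)
  (f : A -> B) : Prop :=
  bijective f /\ forall x y, ltA x y <-> ltB (f x) (f y).

Definition extends {K : Type} (ltK : K -> K -> Prop) (x : K -> K)
  (a : K) (s : seg ltK a -> K) : Prop :=
  forall i : seg ltK a, x (proj1_sig i) = s i.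

Definition kopen {K : Type} (ltK : K -> K -> Prop) (U : (K -> K) -> Prop) : Prop :=
  forall x, U x -> exists (a : K) (s : seg ltK a -> K),
    extends ltK x a s /\ forall y, extends ltK y a s -> U y.

Definition kclosure {K : Type} (ltK : K -> K -> Prop) (A : (K -> K) -> Prop)
  (x : K -> K) : Prop :=
  forall (a : K) (s : seg ltK a -> K), extends ltK x a s ->
    exists y, extends ltK y a s /\ A y.

Definition nowhere_dense {K : Type} (ltK : K -> K -> Prop) (A : (K -> K) -> Prop) : Prop :=
  forall U, kopen ltK U -> (forall x, U x -> kclosure ltK A x) -> forall x, ~ U x.

Definition baire_property {K : Type} (ltK : K -> K -> Prop) (A : (K -> K) -> Prop) : Prop :=
  exists (U : (K -> K) -> Prop) (Nd : K -> (K -> K) -> Prop),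
    kopen ltK U /\ (forall al, nowhere_dense ltK (Nd al)) /\
    forall x, ((A x /\ ~ U x) \/ (U x /\ ~ A x)) -> exists al, Nd al x.

Definition kopen2 {K : Type} (ltK : K -> K -> Prop) (U : (K -> K) * (K -> K) -> Prop) : Prop :=
  forall p, U p -> exists (a : K) (s : seg ltK a -> K) (b : K) (t : seg ltK b -> K),
    extends ltK (fst p) a s /\ extends ltK (snd p) b t /\
    forall q, extends ltK (fst q) a s -> extends ltK (snd q) b t -> U q.

Definition kclosed2 {K : Type} (ltK : K -> K -> Prop) (C : (K -> K) * (K -> K) -> Prop) : Prop :=
  kopen2 ltK (fun p => ~ C p).

Definition sigma11 {K : Type} (ltK : K -> K -> Prop) (A : (K -> K) -> Prop) : Prop :=
  exists C, kclosed2 ltK C /\ forall x, A x <-> exists y, C (x, y).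

Definition delta11 {K : Type} (ltK : K -> K -> Prop) (A : (K -> K) -> Prop) : Prop :=
  sigma11 ltK A /\ sigma11 ltK (fun x => ~ A x).

Definition predecessors {T : Type} (lt : T -> T -> Prop) (t : T) : Type :=
  { x : T | lt x t }.

Definition on_level {T K : Type} (ltK : K -> K -> Prop) (lt : T -> T -> Prop)
  (t : T) (a : K) : Prop :=
  exists f : predecessors lt t -> seg ltK a,
    order_iso (fun x y => lt (proj1_sig x) (proj1_sig y))
              (fun x y => ltK (proj1_sig x) (proj1_sig y)) f.

Definition tree_of_height {T K : Type} (ltK : K -> K -> Prop) (lt : T -> T -> Prop) : Prop :=
  (forall x, ~ lt x x) /\
  (forall x y z, lt x y -> lt y z -> lt x z) /\
  (forall t x y, lt x t -> lt y t -> lt x y \/ x = y \/ lt y x) /\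
  (forall t, exists a, on_level ltK lt t a) /\
  (forall a, exists t, on_level ltK lt t a).

Definition chain {T : Type} (lt : T -> T -> Prop) (C : T -> Prop) : Prop :=
  forall x y, C x -> C y -> lt x y \/ x = y \/ lt y x.

Definition antichain {T : Type} (lt : T -> T -> Prop) (A : T -> Prop) : Prop :=
  forall x y, A x -> A y -> x <> y -> ~ lt x y /\ ~ lt y x.

Definition has_kappa_branch {T K : Type} (ltK : K -> K -> Prop) (lt : T -> T -> Prop) : Prop :=
  exists C : T -> Prop, chain lt C /\
    exists f : { x : T | C x } -> K,
      order_iso (fun x y => lt (proj1_sig x) (proj1_sig y)) ltK f.

Definition aronszajn {T K : Type} (ltK : K -> K -> Prop) (lt : T -> T -> Prop) : Prop :=
  tree_of_height ltK lt /\ ~ has_kappa_branch ltK lt /\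
  forall a : K, ~ inj_le K { t : T | on_level ltK lt t a }.

Definition souslin {T K : Type} (ltK : K -> K -> Prop) (lt : T -> T -> Prop) : Prop :=
  aronszajn ltK lt /\
  forall A : T -> Prop, antichain lt A -> ~ inj_le K { x : T | A x }.

Definition has_souslin_subtree {T K : Type} (ltK : K -> K -> Prop) (lt : T -> T -> Prop) : Prop :=
  exists S : T -> Prop,
    souslin ltK (fun x y : { t : T | S t } => lt (proj1_sig x) (proj1_sig y)).

Definition special {T N : Type} (ltN : N -> N -> Prop) (lt : T -> T -> Prop) : Prop :=
  exists s : T -> N, forall C : T -> Prop, chain lt C ->
    forall x y, C x -> C y -> s x = s y -> x = y.

(* Main.v *)
(* Every [x : K -> K] is read as a tree order on [K] in which the predecessors of [d] form
   a closed subset of [d]; let A be the set of [x] whose order has a chain of length kappa.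
   A is Sigma^1_1. If there is no such chain, insert into the order, between consecutive
   points of each branch, pieces of functions into nu that are coherent modulo sets of
   size < nu and < nu-to-one; this makes the levels small. A subset of the resulting tree
   that is unbounded and has no antichain of size kappa must meet the inserted order
   cofinally on a club, and closedness then turns it into a chain of length kappa. Hence
   the tree is Aronszajn without Souslin subtrees, and so special by hypothesis: a
   function to nu injective on chains witnesses that [x] is not in A, and the complement
   of A is Sigma^1_1 too. Finally, while meeting kappa many dense open sets one may
   prescribe the values of [x] on a club; extending one fixed chain there puts [x] into A,
   and starting over from a root each time keeps [x] out of A, so A cannot have the
   kappa-Baire property. *)
From Stdlib Require Import ssreflect Classical ClassicalEpsilon.
From Stdlib Require Import FunctionalExtensionality PropExtensionality.
Require Import Defs.

Local Open Scope general_if_scope.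

(** * Well-orders *)

Section WellOrders.
Context {A : Type} {lt : A -> A -> Prop} (wo : well_order lt).

Lemma wo_irr x : ~ lt x x.
Proof. by case: wo. Qed.

Lemma wo_trans x y z : lt x y -> lt y z -> lt x z.
Proof. by case: wo => _ [h _]; apply: h. Qed.

Lemma wo_total x y : lt x y \/ x = y \/ lt y x.
Proof. by case: wo => _ [_ [h _]]. Qed.

Lemma wo_wf : well_founded lt.
Proof. by case: wo => _ [_ [_ h]]. Qed.

Lemma wo_nlt x y : ~ lt x y -> x = y \/ lt y x.
Proof. by case: (wo_total x y). Qed.

Lemma wo_le_lt_trans x y z : ~ lt y x -> lt y z -> lt x z.
Proof. by move=> /wo_nlt [->|h] // h'; apply: wo_trans h h'. Qed.

Lemma wo_lt_le_trans x y z : lt x y -> ~ lt z y -> lt x z.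
Proof. by move=> h /wo_nlt [->|h'] //; apply: wo_trans h h'. Qed.

Lemma wo_le_trans x y z : ~ lt y x -> ~ lt z y -> ~ lt z x.
Proof. by move=> h1 h2 h; apply: h1; apply: wo_le_lt_trans h2 h. Qed.

Lemma wo_antisym x y : ~ lt x y -> ~ lt y x -> x = y.
Proof. by case: (wo_total x y) => [?|[]]. Qed.

Lemma wo_least (P : A -> Prop) :
  (exists x, P x) -> exists x, P x /\ forall y, P y -> ~ lt y x.
Proof.
move=> [x]; elim: x / (wo_wf x) => x _ ih px.
case: (classic (exists y, P y /\ lt y x)) => [[y [py yx]]|h]; first exact: ih yx py.
by exists x; split=> // y py yx; apply: h; exists y.
Qed.

Lemma wo_ub2 x y : exists z, ~ lt z x /\ ~ lt z y.
Proof.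
case: (classic (lt x y)) => h; last by exists x; split=> //; apply: wo_irr.
by exists y; split; [move=> h'; apply: (wo_irr x); apply: wo_trans h h'|apply: wo_irr].
Qed.

Lemma increasing_ge (f : A -> A) (D : A -> Prop) :
  (forall x y, D y -> lt x y -> D x) ->
  (forall x y, D y -> lt x y -> lt (f x) (f y)) ->
  forall x, D x -> ~ lt (f x) x.
Proof.
move=> Dd fi x; elim: x / (wo_wf x) => x _ ih Dx fx.
have Dfx := Dd _ _ Dx fx.
by apply: (ih (f x) fx Dfx); apply: fi.
Qed.

(** Locality of [R] lets a function known only below [a] be padded with [b0], so the recursion can
    run over total functions. *)
Lemma wo_choice {B : Type} (b0 : B) (R : A -> (A -> B) -> B -> Prop) :
  (forall a f g v, (forall b, lt b a -> f b = g b) -> R a f v -> R a g v) ->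
  (forall a f, (forall b, lt b a -> R b f (f b)) -> exists v, R a f v) ->
  exists F, forall a, R a F (F a).
Proof.
move=> loc ex.
pose ext a (f : forall b, lt b a -> B) b :=
  match excluded_middle_informative (lt b a) with left h => f b h | right _ => b0 end.
pose G a f := epsilon (inhabits b0) (R a (ext a f)).
pose F := Fix wo_wf (fun _ => B) G.
have FE a : F a = G a (fun b _ => F b).
  rewrite /F Fix_eq // => x f g fg; congr G.
  by apply: functional_extensionality_dep => y; apply: functional_extensionality_dep.
have extE a b : lt b a -> ext a (fun b _ => F b) b = F b.
  by rewrite /ext; case: excluded_middle_informative.
exists F => a; elim: a / (wo_wf a) => a _ ih.
rewrite FE; apply: (loc _ (ext a (fun b _ => F b))); first exact: extE.
apply: epsilon_spec; apply: ex => b ba; rewrite extE //.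
apply: loc (ih b ba) => c cb; rewrite extE //; exact: wo_trans cb ba.
Qed.

End WellOrders.

Lemma dependent_choice_fun {A B : Type} (R : A -> B -> Prop) :
  (forall a, exists b, R a b) -> exists f, forall a, R a (f a).
Proof.
move=> h; exists (fun a => proj1_sig (constructive_indefinite_description _ (h a))) => a.
by case: constructive_indefinite_description.
Qed.

Lemma sig_eq {A : Type} (P : A -> Prop) (u v : {x | P x}) : proj1_sig u = proj1_sig v -> u = v.
Proof.
case: u v => [x px] [y py] /= e; subst y; congr exist; exact: proof_irrelevance.
Qed.

Lemma inj_le_trans {A B C : Type} : inj_le A B -> inj_le B C -> inj_le A C.
Proof.
by move=> [f fi] [g gi]; exists (fun x => g (f x)) => x y /gi/fi.
Qed.

(** * Sets of size less than nu, and bounded subsets of kappa *)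

Section Small.
Context {N : Type} (ltN : N -> N -> Prop) (Hnu : infinite_cardinal ltN)
  (Hnu_lt : equipotent { a : N & (seg ltN a -> N) } N).

Notation "x <n y" := (ltN x y) (at level 70).

Let woN : well_order ltN.
Proof. by case: Hnu => [[]]. Qed.

Lemma two_below : exists a m0 m1, m0 <n a /\ m1 <n a /\ m0 <> m1.
Proof.
case: Hnu => _ [f fi].
have d01 : f 0 <> f 1 by move=> /fi.
have d02 : f 0 <> f 2 by move=> /fi.
have d12 : f 1 <> f 2 by move=> /fi.
case: (wo_total woN (f 0) (f 1)) => [h01|[//|h01]];
case: (wo_total woN (f 0) (f 2)) => [h02|[//|h02]];
case: (wo_total woN (f 1) (f 2)) => [h12|[//|h12]].
- by exists (f 2), (f 0), (f 1).
- by exists (f 1), (f 0), (f 2).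
- by exists (f 1), (f 0), (f 2); have := wo_trans woN _ _ _ h02 h01; auto.
- by exists (f 1), (f 0), (f 2).
- by exists (f 2), (f 0), (f 1).
- by exists (f 2), (f 0), (f 1); have := wo_trans woN _ _ _ h01 h02; auto.
- by exists (f 0), (f 1), (f 2).
- by exists (f 0), (f 1), (f 2).
Qed.

(** A pair becomes a function on a segment with at least two points, [m] at [m0] and [n] elsewhere;
    [nu ^< nu = nu] codes it by a point of [N]. *)
Lemma pairing : exists pr : N -> N -> N,
  forall m n m' n', pr m n = pr m' n' -> m = m' /\ n = n'.
Proof.
have [a [m0 [m1 [l0 [l1 d]]]]] := two_below.
have [G [Gi _]] := Hnu_lt.
pose c m n : {a : N & (seg ltN a -> N)} := existT _ a (fun i =>
  if excluded_middle_informative (proj1_sig i = m0) then m else n).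
exists (fun m n => G (c m n)) => m n m' n' /Gi e.
have {}e := inj_pair2 _ _ _ _ _ e.
split.
- have := equal_f e (exist _ m0 l0); cbn.
  by case: excluded_middle_informative.
- have := equal_f e (exist _ m1 l1); cbn.
  by case: excluded_middle_informative => // h; case: d.
Qed.

Definition small {A : Type} (P : A -> Prop) : Prop := ~ inj_le N {x | P x}.

Lemma small_sub {A : Type} (P Q : A -> Prop) :
  (forall x, P x -> Q x) -> small Q -> small P.
Proof.
move=> PQ sQ [f fi]; apply: sQ.
exists (fun n => exist _ (proj1_sig (f n)) (PQ _ (proj2_sig (f n)))) => m n [] e.
by apply: fi; apply: sig_eq.
Qed.

Lemma small1 {A : Type} (a : A) : small (fun x => x = a).
Proof.
have [_ [m0 [m1 [_ [_ d]]]]] := two_below.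
move=> [f fi]; apply: d; apply: fi; apply: sig_eq.
by rewrite (proj2_sig (f m0)) (proj2_sig (f m1)).
Qed.

(* Regularity of [nu], by Koenig's diagonal argument against [nu ^< nu = nu]. *)
Lemma small_bigU {A : Type} (a : N) (P : N -> A -> Prop) :
  (forall i, i <n a -> small (P i)) -> small (fun x => exists i, i <n a /\ P i x).
Proof.
move=> sP [f fi].
have [G [Gi _]] := Hnu_lt.
pose H (g : seg ltN a -> N) := f (G (existT _ a g)).
have Hi g g' : H g = H g' -> g = g' by move=> /fi/Gi e; apply: inj_pair2 e.
(* If all values occurred at [i] among the [g] with [H g] in [P i], then [P i] would contain a copy
   of [N]. The omitted values form an [h] with [H h] in no [P i]. *)
have ex (i : seg ltN a) : exists v, forall g, P (proj1_sig i) (proj1_sig (H g)) -> g i <> v.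
  apply: NNPP => h; apply: (sP _ (proj2_sig i)).
  have {}h v : exists g, P (proj1_sig i) (proj1_sig (H g)) /\ g i = v.
    apply: NNPP => h'; apply: h; exists v => g p e; apply: h'; by exists g.
  have [g gP] := dependent_choice_fun _ h.
  exists (fun v => exist _ _ (proj1 (gP v))) => v w [] e.
  rewrite -(proj2 (gP v)) -(proj2 (gP w)).
  by have -> : g v = g w by apply: Hi; apply: sig_eq.
have [h hP] := dependent_choice_fun _ ex.
have [i [ia p]] := proj2_sig (H h).
exact: (hP (exist _ i ia) h p).
Qed.

Lemma smallU {A : Type} (P Q : A -> Prop) :
  small P -> small Q -> small (fun x => P x \/ Q x).
Proof.
move=> sP sQ.
have [a [m0 [m1 [l0 [l1 d]]]]] := two_below.
pose R i := if excluded_middle_informative (i = m0) then P else Q.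
have := small_bigU a R.
have sR i : i <n a -> small (R i) by rewrite /R; case: excluded_middle_informative.
move=> /(_ sR); apply: small_sub => x [p|q].
- by exists m0; split=> //; rewrite /R; case: excluded_middle_informative.
- exists m1; split=> //; rewrite /R; case: excluded_middle_informative => // e.
  by case: d.
Qed.

Lemma small_bigU_le {A : Type} (a : N) (P : N -> A -> Prop) :
  (forall i, small (P i)) -> small (fun x => exists i, ~ a <n i /\ P i x).
Proof.
move=> sP.
apply: small_sub (smallU _ _ (small_bigU a P (fun i _ => sP i)) (sP a)) => x [i [ia p]].
by case: (wo_nlt woN _ _ ia) => [->|h]; [right|left; exists i].
Qed.

(** Greedy enumeration along [N] stops at a first [a], as otherwise it would inject [N] into [P]. *)
Lemma small_enum {A : Type} (P : A -> Prop) :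
  small P -> exists (a : N) (phi : seg ltN a -> A), forall x, P x <-> exists i, phi i = x.
Proof.
move=> sP.
pose fresh n (f : N -> option A) x := P x /\ forall m, m <n n -> f m <> Some x.
pose R n f v := match v with Some x => fresh n f x | None => ~ exists x, fresh n f x end.
have [F FP] : exists F, forall n, R n F (F n).
  apply: (wo_choice woN None) => [n f g v fg|n f _].
    have E x : fresh n f x <-> fresh n g x.
      by split=> -[p h]; split=> // m mn; [rewrite -fg|rewrite fg]; auto.
    by case: v => [x /E|h [x /E px]] //; apply: h; exists x.
  case: (classic (exists x, fresh n f x)) => [[x h]|h]; first by exists (Some x).
  by exists None.
case: (classic (exists n, F n = None)) => [h|h]; last first.
  have {}h n : exists x, F n = Some x.
    by case E : (F n) => [x|]; [exists x|case: h; exists n].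
  have [g gP] := dependent_choice_fun _ h.
  have gF n : fresh n F (g n) by have := FP n; rewrite gP.
  case: sP; exists (fun n => exist _ (g n) (proj1 (gF n))) => m n [] e.
  by apply: (wo_antisym woN) => l;
   [case: (gF n) => _ /(_ m l)|case: (gF m) => _ /(_ n l)]; rewrite gP e.
have [a [Fa amin]] := wo_least woN _ h.
have ex (i : seg ltN a) : exists x, F (proj1_sig i) = Some x.
  case E : (F (proj1_sig i)) => [x|]; first by exists x.
  by case: (amin _ E (proj2_sig i)).
have [phi phiP] := dependent_choice_fun _ ex.
exists a, phi => x; split=> [px|[i <-]].
- apply: NNPP => h'; have := FP a; rewrite Fa => /=; apply; exists x; split=> // m ma e.
  by apply: h'; exists (exist _ m ma); have := phiP (exist _ m ma); rewrite /= e => -[].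
- by have := FP (proj1_sig i); rewrite phiP => -[].
Qed.

Lemma small_fresh {A : Type} (P : A -> Prop) (c : A -> N) :
  small P -> exists v, forall x, P x -> c x <> v.
Proof.
move=> sP; apply: NNPP => h; apply: sP.
have {}h v : exists x, P x /\ c x = v.
  apply: NNPP => h'; apply: h; exists v => x p e; apply: h'; by exists x.
have [g gP] := dependent_choice_fun _ h.
exists (fun v => exist _ _ (proj1 (gP v))) => v w [] e.
by rewrite -(proj2 (gP v)) -(proj2 (gP w)) e.
Qed.

End Small.

(** * Regularity of kappa and closure points *)

Section Successor.
Context {N K : Type} (ltN : N -> N -> Prop) (ltK : K -> K -> Prop)
  (Hnu : infinite_cardinal ltN)
  (Hnu_lt : equipotent { a : N & (seg ltN a -> N) } N)
  (Hkappa : successor_cardinal_of ltN ltK).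

Notation "x <n y" := (ltN x y) (at level 70).
Notation "x <k y" := (ltK x y) (at level 70).

Lemma succ_wo : well_order ltK.
Proof. by case: Hkappa => [[]]. Qed.
Let woK := succ_wo.

Lemma succ_not_inj : ~ inj_le K N.
Proof. by case: Hkappa => _ [_ []]. Qed.

Lemma seg_indexing : exists idx : K -> K -> N,
  forall d a b, a <k d -> b <k d -> idx d a = idx d b -> a = b.
Proof.
have [_ [_ [_ h]]] := Hkappa.
have [n0 _] := two_below ltN Hnu.
have ex (d : K) : exists g : K -> N, forall a b, a <k d -> b <k d -> g a = g b -> a = b.
  have [f fi] := h d.
  exists (fun a => match excluded_middle_informative (a <k d) with
                   | left l => f (exist _ a l) | right _ => n0 end) => a b ad bd.
  case: excluded_middle_informative => // l; case: excluded_middle_informative => // l'.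
  by move=> /fi [].
exact: dependent_choice_fun _ ex.
Qed.

(** Regularity of kappa: otherwise every [b] is at most some [f n], and [n] with the index of [b]
    below [f n] determines [b], so [K] injects into [N]. *)
Lemma bounded_below_N (f : N -> K) : exists b, forall n, f n <k b.
Proof.
apply: NNPP => h; apply: succ_not_inj.
have [pr prP] := pairing ltN Hnu Hnu_lt.
have [idx idxP] := seg_indexing.
have [n0 _] := two_below ltN Hnu.
have {}h b : exists n, ~ f n <k b.
  by apply: NNPP => h'; apply: h; exists b => n; apply: NNPP => h''; apply: h'; exists n.
have [g gP] := dependent_choice_fun _ h.
have [pr2 pr2P] : exists pr2 : bool -> N -> N, forall x m y n, pr2 x m = pr2 y n -> x = y /\ m = n.
  have [_ [m0 [m1 [_ [_ d]]]]] := two_below ltN Hnu.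
  exists (fun x : bool => pr (if x then m0 else m1)) => x m y n /prP [].
  by case: x; case: y => // e; case: d; rewrite e.
(* The Boolean marks the case [b = f (g b)], as [idx] is injective only strictly below its first
   argument. *)
exists (fun b => pr (g b) (pr2 (if excluded_middle_informative (b = f (g b)) then true else false)
                            (idx (f (g b)) b))) => a b /prP [e] /pr2P [].
case: excluded_middle_informative => [ea|na]; case: excluded_middle_informative => [eb|nb] //.
  by rewrite ea eb e.
move=> _; rewrite e => /idxP; apply.
- by have := gP a; rewrite e => /(wo_nlt woK) [h'|//]; case: na; rewrite e.
- by have := gP b => /(wo_nlt woK) [h'|//]; case: nb.
Qed.

Lemma no_max (a : K) : exists b, a <k b.
Proof.
have [b h] := bounded_below_N (fun _ => a); have [n0 _] := two_below ltN Hnu.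
by exists b; apply: (h n0).
Qed.

Lemma N_to_seg (d a : K) : a <k d -> exists f : N -> K, forall b, b <k d -> exists n, f n = b.
Proof.
move=> ad; have [idx idxP] := seg_indexing.
have ex n : exists b, forall c, c <k d -> idx d c = n -> c = b.
  case: (classic (exists c, c <k d /\ idx d c = n)) => [[c [cd e]]|h].
    by exists c => c' c'd e'; apply: (idxP d) => //; rewrite e' e.
  by exists a => c cd e; case: h; exists c.
have [f fP] := dependent_choice_fun _ ex.
by exists f => b bd; exists (idx d b); rewrite -(fP _ b).
Qed.

Lemma bounded_below_seg (d : K) (f : K -> K) : exists b, forall a, a <k d -> f a <k b.
Proof.
case: (classic (exists a, a <k d)) => [[a ad]|h]; last first.
  by exists d => a ad; case: h; exists a.
have [e eP] := N_to_seg d a ad.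
have [b bP] := bounded_below_N (fun n => f (e n)).
by exists b => c /eP [n <-].
Qed.

(** Iterate a map dominating [h] countably often from [a]; the least strict bound of the iterates is
    closed under [h]. *)
Lemma closure_point (h : K -> K) (a : K) :
  exists d, a <k d /\ forall x, x <k d -> h x <k d.
Proof.
have ex (x : K) : exists b, x <k b /\ forall y, ~ x <k y -> h y <k b.
  have [x' xx'] := no_max x.
  have [b bP] := bounded_below_seg x' h.
  have [c [cb cx']] := wo_ub2 woK b x'.
  exists c; split; first exact: (wo_lt_le_trans woK) xx' cx'.
  move=> y yx; apply: (wo_lt_le_trans woK _ b) => //.
  by apply: bP; apply: (wo_le_lt_trans woK) yx xx'.
have [g gP] := dependent_choice_fun _ ex.
pose s := fix s n := match n with 0 => a | S n => g (s n) end.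
have [b bP] : exists b, forall n, s n <k b.
  have [_ [j ji]] := Hnu.
  have [n0 _] := two_below ltN Hnu.
  pose r m := epsilon (inhabits 0) (fun n => j n = m).
  have [b bP] := bounded_below_N (fun m => s (r m)).
  exists b => n; have := bP (j n).
  have -> // : r (j n) = n.
  by apply: ji; apply: (epsilon_spec (inhabits 0) (fun k => j k = j n)); exists n.
have [d [dP dmin]] := wo_least woK (fun b => forall n, s n <k b) (ex_intro _ b bP).
exists d; split; first exact: (dP 0).
move=> x xd.
have [n nP] : exists n, ~ s n <k x.
  by apply: not_all_ex_not => h'; apply: (dmin _ h').
apply: (wo_lt_le_trans woK _ (s (S n))); first exact: (proj2 (gP (s n))).
by move=> l; apply: (wo_irr woK d); apply: (wo_trans woK) l (dP _).
Qed.

Lemma increasing_in_unbounded (Y : K -> Prop) : (forall a, exists b, Y b /\ a <k b) ->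
  exists z : K -> K, (forall a, Y (z a)) /\ forall a b, a <k b -> z a <k z b.
Proof.
move=> Yu.
have [k0 _] : exists k : K, True.
  by have [_ [[f _] _]] := Hkappa; have [n0 _] := two_below ltN Hnu; exists (f n0).
have [z zP] := wo_choice woK k0
  (fun a f v => Y v /\ forall b, b <k a -> f b <k v)
  ltac:(move=> a f g v fg [yv h]; split=> // b ba; rewrite -fg //; exact: h)
  ltac:(move=> a f _; have [b bP] := bounded_below_seg a f; have [c [Yc bc]] := Yu b;
        exists c; split=> // x xa; apply: (wo_trans woK) bc; exact: bP).
exists z; split=> [a|a b ab]; first by case: (zP a).
by case: (zP b) => _; apply.
Qed.

Lemma increasing_inj (z : K -> K) : (forall a b, a <k b -> z a <k z b) -> injective z.
Proof.
move=> zi a b e; apply: (wo_antisym woK) => l; have := zi _ _ l; rewrite e; exact: wo_irr.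
Qed.

(** If each fibre were bounded, the [nu] many bounds would have a common bound, and this would bound
    all of [K]. *)
Lemma unbounded_fiber (c : K -> N) : exists n, forall a, exists b, c b = n /\ a <k b.
Proof.
apply: NNPP => h; apply: succ_not_inj.
have ex n : exists a, forall b, c b = n -> ~ a <k b.
  apply: NNPP => h'; apply: h; exists n => a; apply: NNPP => h''; apply: h'.
  by exists a => b e ab; apply: h''; exists b.
have [a aP] := dependent_choice_fun _ ex.
have [d dP] := bounded_below_N a.
have bd (b : K) : b <k d by apply: (wo_le_lt_trans woK) (aP _ _ eq_refl) (dP _).
by case: (wo_irr woK d (bd d)).
Qed.

End Successor.

(** * Coherent functions *)

Section Coherent.
Context {N K : Type} {ltN : N -> N -> Prop} {ltK : K -> K -> Prop}
  (Hnu : infinite_cardinal ltN)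
  (Hnu_lt : equipotent { a : N & (seg ltN a -> N) } N)
  (Hkappa : successor_cardinal_of ltN ltK).

Notation "x <n y" := (ltN x y) (at level 70).
Notation "x <k y" := (ltK x y) (at level 70).

Let woN : well_order ltN.
Proof. by case: Hnu => [[]]. Qed.
Let woK : well_order ltK := succ_wo _ _ Hkappa.

(* [e a x] is the largest index met on a walk from [a] down to [x]. *)
Lemma coherent_functions : exists e : K -> K -> N,
  (forall a i, small (N := N) (fun x => x <k a /\ ~ i <n e a x)) /\
  (forall a b, b <k a -> small (N := N) (fun x => x <k b /\ e a x <> e b x)).
Proof.
have [idx idxP] := seg_indexing _ _ Hnu Hkappa.
have [n0 _] := two_below ltN Hnu.
(* [B a x] will be the first step of the walk from [a] to [x]: the point of [[x, a)] with least
   index [idx a]. *)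
have exB (p : K * K) : exists c, snd p <k fst p -> ~ c <k snd p /\ c <k fst p /\
    forall b, ~ b <k snd p -> b <k fst p -> ~ idx (fst p) b <n idx (fst p) c.
  case: p => a x /=; case: (classic (x <k a)) => [xa|?]; last by exists a.
  have [|k [[c [cx [ca <-]]] kmin]] :=
    wo_least woN (fun k => exists c, ~ c <k x /\ c <k a /\ idx a c = k).
    by exists (idx a x), x; split=> //; apply: wo_irr woK x.
  by exists c => _; split=> //; split=> // b bx ba; apply: kmin; exists b.
have [B' B'P] := dependent_choice_fun _ exB.
pose B a x := B' (a, x).
have BP a x : x <k a -> ~ B a x <k x /\ B a x <k a /\
    forall b, ~ b <k x -> b <k a -> ~ idx a b <n idx a (B a x) := B'P (a, x).
pose maxN m n := if excluded_middle_informative (m <n n) then n else m.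
pose E a (f : K -> K -> N) x := if excluded_middle_informative (B a x = x) then idx a x
  else maxN (f (B a x) x) (idx a (B a x)).
have [e eP] := wo_choice woK (fun _ => n0) (fun a f v => forall x, x <k a -> v x = E a f x)
  ltac:(move=> a f g v fg h x xa; rewrite h // /E; case: excluded_middle_informative => //;
        by rewrite fg //; case: (BP _ _ xa) => _ [])
  ltac:(by move=> a f _; exists (E a f)).
exists e.
(* Each index names at most one first step [c], so a union over steps with bounded index is a union
   over a bounded part of [N] and stays small. *)
have fibre a (Q : K -> K -> Prop) : (forall c, c <k a -> small (N := N) (Q c)) ->
    forall k, small (N := N) (fun x => exists c, c <k a /\ idx a c = k /\ Q c x).
  move=> sQ k; case: (classic (exists c, c <k a /\ idx a c = k)) => [[c [ca ck]]|h].
    apply: small_sub (sQ c ca) => x [c' [c'a [c'k q]]].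
    by have <- : c' = c by apply: (idxP a) => //; rewrite ck.
  apply: small_sub (small1 ltN Hnu a) => x [c [ca [ck _]]].
  by case: h; exists c.
have s1 := small1 ltN Hnu (A := K).
have sU := smallU ltN Hnu Hnu_lt (A := K).
have sB := small_bigU_le ltN Hnu Hnu_lt (A := K).
have sS := small_sub (N := N) (A := K).
suff main a : (forall i, small (N := N) (fun x => x <k a /\ ~ i <n e a x)) /\
  (forall b, b <k a -> small (N := N) (fun x => x <k b /\ e a x <> e b x)).
  by split=> [a|a b ba]; case: (main a); auto.
elim: a / (wo_wf woK a) => a _ ih; split=> [i|b ba].
- have S k := fibre a (fun c x => x = c \/ (x <k c /\ ~ i <n e c x))
    (fun c ca => sU _ _ (s1 c) (proj1 (ih c ca) i)) k.
  apply: (sS) (sB i _ S) => x [xa ix].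
  have [cx [ca _]] := BP _ _ xa.
  have h : ~ i <n idx a (B a x) /\ (x <k B a x -> ~ i <n e (B a x) x).
  { move: ix; rewrite eP // /E; case: excluded_middle_informative => [->|nx].
      by move=> h; split=> // /(wo_irr woK).
    rewrite /maxN; case: excluded_middle_informative => [l|l] ix; split=> //.
    + by move=> _ l2; apply: ix; exact: (wo_trans woN _ _ _ l2 l).
    + exact: (wo_le_trans woN _ _ _ l ix). }
  exists (idx a (B a x)); split; first by case: h.
  exists (B a x); split=> //; split=> //.
  by case: (wo_nlt woK _ _ cx) => [->|l]; [left|right; split=> //; case: h => _; apply].
(* As [b] lies in [[x, a)], the first step [c] has index at most that of [b]. A disagreement at [x]
   means that the walk ends at [c], that [e c x] is at most the index of [c], or that [e c x] and
   [e b x] already differ. *)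
- have sQ c : c <k a -> small (N := N) (fun x => x = c \/
    ((x <k c /\ ~ idx a c <n e c x) \/ (x <k c /\ x <k b /\ e c x <> e b x))).
  { move=> ca; apply: (sU); first exact: (s1).
    apply: (sU); first exact: (proj1 (ih c ca) (idx a c)).
    case: (wo_total woK c b) => [cb|[->|bc]].
    + by apply: (sS) (proj2 (ih b ba) c cb) => x [xc [_ d]]; split=> // h0; apply: d; rewrite h0.
    + by apply: (sS) (s1 b) => x [_ [_ []]].
    + by apply: (sS) (proj2 (ih c ca) b bc) => x [_ h]. }
  apply: (sS) (sB (idx a b) _ (fibre a _ sQ)) => x [xb d].
  have xa := wo_trans woK _ _ _ xb ba.
  have [cx [ca cmin]] := BP _ _ xa.
  exists (idx a (B a x)); split.
    by apply: cmin => // /(wo_trans woK _ _ _ xb)/(wo_irr woK).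
  exists (B a x); split=> //; split=> //.
  move: d; rewrite (eP a) // /E; case: excluded_middle_informative => [->|nx]; first by left.
  have xc : x <k B a x by case: (wo_nlt woK _ _ cx) nx => [->|].
  rewrite /maxN; case: excluded_middle_informative => [l|l] d; right; last by right.
  by left; split=> // /(wo_trans woN _ _ _ l)/(wo_irr woN).
Qed.

(** Each [e m] with [m] at least [a] differs from [e a] below [a] on a set of size less than [nu],
    and [nu ^< nu = nu] leaves at most [nu] such modifications. *)
Lemma thin_restrictions (e : K -> K -> N)
  (eco : forall a b, b <k a -> small (N := N) (fun x => x <k b /\ e a x <> e b x)) (a : K) :
  exists code : K -> N, forall m m', ~ m <k a -> ~ m' <k a -> code m = code m' ->
    forall x, x <k a -> e m x = e m' x.
Proof.
have [idx idxP] := seg_indexing _ _ Hnu Hkappa.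
have [pr prP] := pairing ltN Hnu Hnu_lt.
have [n0 _] := two_below ltN Hnu.
have [G [Gi _]] := Hnu_lt.
pose D m x := x <k a /\ e m x <> e a x.
(* The function [e m] below [a] is recorded by its graph over the small set where it
   differs from [e a]. *)
have ex m : exists c : {b : N & (seg ltN b -> N)}, ~ m <k a ->
    forall n, (exists i, projT2 c i = n) <-> exists x, D m x /\ n = pr (idx a x) (e m x).
  { case: (classic (m <k a)) => [ma|ma]; first by exists (existT _ n0 (fun _ => n0)).
  have sD : small (N := N) (D m).
    case: (wo_nlt woK _ _ ma) => [m_a|]; last exact: eco.
    by apply: small_sub (small1 ltN Hnu m) => x [_]; rewrite m_a; case.
  have [b [phi phiP]] := small_enum ltN Hnu _ sD.
  exists (existT _ b (fun i => pr (idx a (phi i)) (e m (phi i)))) => _ n /=; split.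
  - by move=> [i <-]; exists (phi i); split=> //; apply/phiP; exists i.
  - by move=> [x [/phiP [i <-] ->]]; exists i. }
have [c cP] := dependent_choice_fun _ ex.
exists (fun m => G (c m)) => m m' ma m'a /Gi e_c x xa.
have half u v : ~ u <k a -> ~ v <k a -> c u = c v -> D u x -> e u x = e v x.
  move=> ua va uv Dx.
  have : exists i, projT2 (c u) i = pr (idx a x) (e u x) by apply/cP => //; exists x.
  rewrite uv => /cP [//|y [[ya _] /prP [ixy ->]]].
  by rewrite (idxP a x y).
case: (classic (D m x)) => h; first exact: half.
case: (classic (D m' x)) => h'; first by symmetry; apply: half.
have -> : e m x = e a x by apply: NNPP => ?; apply: h.
by apply: NNPP => ?; apply: h'; split=> // h0; auto.
Qed.

End Coherent.

(** * The thin tree over a closed tree order *)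

Section ThinTree.
Context {N K : Type} {ltN : N -> N -> Prop} {ltK : K -> K -> Prop}
  (Hnu : infinite_cardinal ltN)
  (Hnu_lt : equipotent { a : N & (seg ltN a -> N) } N)
  (Hkappa : successor_cardinal_of ltN ltK).

Notation "x <n y" := (ltN x y) (at level 70).
Notation "x <k y" := (ltK x y) (at level 70).

Let woN : well_order ltN.
Proof. by case: Hnu => [[]]. Qed.
Let woK : well_order ltK := succ_wo _ _ Hkappa.

(** Coherence makes [tri] a tree order: it gives transitivity and compares any two predecessors of a
    point. *)
Context (tri : K -> K -> Prop)
  (tri_lt : forall c d, tri c d -> c <k d)
  (tri_coh : forall c d, tri c d -> forall x, x <k c -> (tri x c <-> tri x d))
  (tri_closed : forall d c, c <k d -> (exists x, tri x d /\ x <k c) ->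
     (forall a, a <k c -> exists x, tri x d /\ a <k x /\ x <k c) -> tri c d).

Context (e : K -> K -> N)
  (e_small : forall a i, small (N := N) (fun x => x <k a /\ ~ i <n e a x))
  (e_coh : forall a b, b <k a -> small (N := N) (fun x => x <k b /\ e a x <> e b x)).

Context (nxt : K -> K -> K)
  (nxtP : forall d x, x <k d -> x <k nxt d x /\ (nxt d x = d \/ tri (nxt d x) d) /\
     forall m, x <k m -> m = d \/ tri m d -> ~ m <k nxt d x).

Lemma nxt_eq d x m : x <k d -> x <k m -> m = d \/ tri m d ->
  (forall c, tri c d -> x <k c -> ~ c <k m) -> nxt d x = m.
Proof.
move=> xd xm md mmin; have [h1 [h2 h3]] := nxtP _ _ xd.
apply: (wo_antisym woK); last exact: h3.
case: h2 => [->|h2]; last exact: mmin.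
by case: md => [->|/tri_lt l /(wo_trans woK _ _ _ l)]; apply: (wo_irr woK).
Qed.

(* The branch [d] carries [None] exactly at the predecessors of [d] in the given tree,
   and on the gaps between them it follows the functions [e]. *)
Definition tb (d x : K) : option N :=
  if excluded_middle_informative (tri x d) then None else Some (e (nxt d x) x).

Lemma tb_None d x : tb d x = None <-> tri x d.
Proof. by rewrite /tb; case: excluded_middle_informative. Qed.

Lemma tb_Some d x m : ~ tri x d -> x <k d -> x <k m -> m = d \/ tri m d ->
  (forall c, tri c d -> x <k c -> ~ c <k m) -> tb d x = Some (e m x).
Proof.
move=> nx xd xm md mmin; rewrite /tb; case: excluded_middle_informative => // _.
by rewrite (nxt_eq d x m).
Qed.

(** * The tree of restrictions of branches *)

Definition agree (a d d' : K) : Prop := forall x, x <k a -> tb d x = tb d' x.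

Lemma agree_sym a d d' : agree a d d' -> agree a d' d.
Proof. by move=> h x xa; rewrite h. Qed.

Lemma agree_trans a d d' d'' : agree a d d' -> agree a d' d'' -> agree a d d''.
Proof. by move=> h h' x xa; rewrite h // h'. Qed.

Lemma agree_le a b d d' : ~ b <k a -> agree b d d' -> agree a d d'.
Proof. by move=> ab h x xa; apply: h; apply: (wo_lt_le_trans woK) xa ab. Qed.

(** Below [c] both branches have the same predecessors, and [c] closes the last gap in either, as
    the top of its own branch and as a predecessor of [d]; so the gaps are filled alike. *)
Lemma agree_tri c d : tri c d -> agree c c d.
Proof.
move=> cd x xc; have xd := wo_trans woK _ _ _ xc (tri_lt _ _ cd).
rewrite {1}/tb; case: excluded_middle_informative => h.
  by symmetry; apply/tb_None/(tri_coh _ _ cd).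
have [h1 [h2 h3]] := nxtP _ _ xc.
symmetry; apply: tb_Some => //.
- by move=> /(tri_coh _ _ cd _ xc).
- right; case: h2 => [->//|h2]; apply/(tri_coh _ _ cd) => //; exact: tri_lt.
- move=> b bd xb bn; apply: (h3 b xb) => //; right; apply/(tri_coh _ _ cd) => //.
  by case: h2 bn => [->//|/tri_lt l l']; apply: (wo_trans woK) l' l.
Qed.

(* A node is a restriction of some [tb d] to some [a]; it is represented by the pair of
   [a] and the least such [d]. *)
Definition node : Type := { p : K * K | ~ snd p <k fst p /\
  forall d, ~ d <k fst p -> agree (fst p) d (snd p) -> ~ d <k snd p }.
Definition lev (u : node) : K := fst (proj1_sig u).
Definition del (u : node) : K := snd (proj1_sig u).
Definition tlt (u v : node) : Prop := lev u <k lev v /\ agree (lev u) (del u) (del v).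

Lemma node_ex a d : ~ d <k a -> exists u, lev u = a /\ agree a (del u) d.
Proof.
move=> da.
have [|c [[ca cd] cmin]] := wo_least woK (fun c => ~ c <k a /\ agree a c d).
  by exists d.
have h : ~ snd (a, c) <k fst (a, c) /\
  forall d, ~ d <k fst (a, c) -> agree (fst (a, c)) d (snd (a, c)) -> ~ d <k snd (a, c).
  by split=> //= b ba bc; apply: cmin; split=> //; apply: agree_trans bc cd.
by exists (exist _ (a, c) h).
Qed.

Lemma lev_del u : ~ del u <k lev u.
Proof. by case: u => [p []]. Qed.

Lemma node_eq u v : lev u = lev v -> agree (lev u) (del u) (del v) -> u = v.
Proof.
move=> euv uv; apply: sig_eq.
have : del u = del v.
{ apply: (wo_antisym woK).
  - apply: (proj2 (proj2_sig v)); rewrite -/(lev v) -/(del v) -euv //; exact: lev_del.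
  - apply: (proj2 (proj2_sig u)); last exact: agree_sym.
    rewrite -/(lev u) euv; exact: lev_del. }
by move: euv; rewrite /lev /del; case: (proj1_sig u) (proj1_sig v) => [a d] [b c] /= -> ->.
Qed.

Lemma tlt_irr u : ~ tlt u u.
Proof. by move=> [/(wo_irr woK)]. Qed.

Lemma tlt_trans u v w : tlt u v -> tlt v w -> tlt u w.
Proof.
move=> [l h] [l' h']; split; first exact: (wo_trans woK) l l'.
apply: agree_trans h _; apply: agree_le h' => l2.
by apply: (wo_irr woK (lev u)); apply: (wo_trans woK) l l2.
Qed.

Lemma on_level_lev u : on_level ltK tlt u (lev u).
Proof.
exists (fun p : predecessors tlt u => exist (fun x => x <k lev u) (lev (proj1_sig p))
  (proj1 (proj2_sig p))).
have ag (p q : predecessors tlt u) : ~ lev (proj1_sig q) <k lev (proj1_sig p) ->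
    agree (lev (proj1_sig p)) (del (proj1_sig p)) (del (proj1_sig q)).
  move: p q => [p [p1 p2]] [q [q1 q2]] /= l.
  by apply: agree_trans p2 _; apply: agree_sym; apply: agree_le q2.
split; first split.
- move=> p q [] l; apply: sig_eq; apply: node_eq => //; apply: ag; rewrite l.
  exact: wo_irr.
- move=> [a al].
  have ad : ~ del u <k a by move=> l; apply: (lev_del u); apply: (wo_trans woK) l al.
  have [v [va h]] := node_ex a (del u) ad.
  have vu : tlt v u by split; rewrite va.
  by exists (exist _ v vu); apply: sig_eq.
- move=> p q /=; split=> [[]//|l]; split=> //; apply: ag => l'.
  by apply: (wo_irr woK (lev (proj1_sig p))); apply: (wo_trans woK) l l'.
Qed.

Lemma iso_seg_le (P : Type) (ltP : P -> P -> Prop) (a b : K) (f : P -> seg ltK a) (h : P -> K) :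
  order_iso ltP (fun x y => proj1_sig x <k proj1_sig y) f ->
  (forall p q, ltP p q -> h p <k h q) -> (forall p, h p <k b) -> ~ b <k a.
Proof.
move=> [[fi fs] fo] hi hb ba.
have ex (x : K) : exists p : P, x <k a -> proj1_sig (f p) = x.
  case: (classic (x <k a)) => xa.
    by have [p px] := fs (exist _ x xa); exists p => _; rewrite px.
  by have [p _] := fs (exist _ _ ba); exists p.
have [g gP] := dependent_choice_fun _ ex.
apply: (increasing_ge woK (fun x => h (g x)) (fun x => x <k a) _ _ b) => //.
- by move=> x y ya xy; apply: (wo_trans woK) xy ya.
- move=> x y ya xy; have xa := wo_trans woK _ _ _ xy ya.
  by apply: hi; apply/fo; rewrite !gP.
Qed.

Lemma on_level_le (S : node -> Prop) (u : {v | S v}) (a : K) :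
  on_level ltK (fun v w : {v | S v} => tlt (proj1_sig v) (proj1_sig w)) u a ->
  ~ lev (proj1_sig u) <k a.
Proof.
move=> [f fP]; apply: (iso_seg_le _ _ _ _ f (fun v => lev (proj1_sig (proj1_sig v))) fP).
- by move=> p q [].
- by move=> p; case: (proj2_sig p).
Qed.

Lemma on_level_unique u a : on_level ltK tlt u a -> lev u = a.
Proof.
move=> [f fP]; have [h hP] := on_level_lev u.
apply: (wo_antisym woK).
- apply: (iso_seg_le _ _ _ _ f (fun v => lev (proj1_sig v)) fP).
  + by move=> p q [].
  + by move=> p; case: (proj2_sig p).
- apply: (iso_seg_le _ _ _ _ h (fun v => proj1_sig (f v)) hP).
  + by move=> p q /(proj2 fP).
  + by move=> p; exact: (proj2_sig (f p)).
Qed.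

Lemma tree_tlt : tree_of_height ltK tlt.
Proof.
split; first exact: tlt_irr.
split; first exact: tlt_trans.
split.
{ move=> w u v [uw hu] [vw hv].
  have ag u' v' : agree (lev u') (del u') (del w) -> agree (lev v') (del v') (del w) ->
      ~ lev v' <k lev u' -> agree (lev u') (del u') (del v').
    by move=> h h' l; apply: agree_trans h _; apply: agree_sym; apply: agree_le h'.
  case: (wo_total woK (lev u) (lev v)) => [l|[l|l]].
  - by left; split=> //; apply: ag => // /(wo_trans woK _ _ _ l)/(wo_irr woK).
  - by right; left; apply: node_eq => //; apply: ag => //; rewrite l; apply: wo_irr.
  - by right; right; split=> //; apply: ag => // /(wo_trans woK _ _ _ l)/(wo_irr woK). }
split=> [u|a]; first by exists (lev u); exact: on_level_lev.
have [u [<- _]] := node_ex a a (wo_irr woK a).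
by exists u; exact: on_level_lev.
Qed.

(** If there are predecessors of [d] below [a] but no largest one, closedness makes their supremum a
    predecessor: it cannot be [a], and below [a] it would be a largest one. *)
Lemma last_predecessor d a : a <k d -> ~ tri a d ->
  (forall x, tri x d -> ~ x <k a) \/
  exists c, tri c d /\ c <k a /\ forall x, tri x d -> c <k x -> ~ x <k a.
Proof.
move=> ad nad; apply: NNPP => h0.
have h c : tri c d -> c <k a -> exists x, tri x d /\ c <k x /\ x <k a.
  move=> cd ca; apply: NNPP => h'; apply: h0; right; exists c; split=> //; split=> // x xd cx xa.
  by apply: h'; exists x.
have [c0 [c0d c0a]] : exists x, tri x d /\ x <k a.
  by apply: NNPP => h'; apply: h0; left=> x xd xa; apply: h'; exists x.
have [s [sP smin]] := wo_least woK (fun s => forall x, tri x d -> x <k a -> x <k s)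
  (ex_intro _ a (fun x _ xa => xa)).
have sa : ~ a <k s by apply: smin.
have slim b : b <k s -> exists x, tri x d /\ b <k x /\ x <k s.
  move=> bs; apply: NNPP => h'; apply: (smin b _ bs) => x xd xa.
  apply: NNPP => xb; have [y [yd [xy ya]]] := h x xd xa.
  apply: h'; exists y; split=> //; split; last exact: sP.
  by apply: (wo_le_lt_trans woK) xb xy.
have sd : tri s d.
  apply: tri_closed => //; first exact: (wo_le_lt_trans woK) sa ad.
  by exists c0; split=> //; apply: sP.
case: (wo_nlt woK _ _ sa) => [es|l]; first by apply: nad; rewrite es.
exact: (wo_irr woK s) (sP s sd l).
Qed.

(** Unless [a] lies on the branch, the part below [a] is determined by the last predecessor there,
    if any, and by the function [e m] filling the gap that reaches [a]; each has at most [nu]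
    possibilities. *)
Lemma thin_levels a : inj_le {u : node | lev u = a} N.
Proof.
have [code codeP] := thin_restrictions Hnu Hnu_lt Hkappa e e_coh a.
have [idx idxP] := seg_indexing _ _ Hnu Hkappa.
have [pr prP] := pairing ltN Hnu Hnu_lt.
have [_ [m0 [m1 [_ [_ m01]]]]] := two_below ltN Hnu.
(* [None] is for [a] being [d] or a predecessor of it, [Some None] for no predecessor below [a], and
   [Some (Some c)] for a last predecessor [c] below [a]. *)
pose Rep d (o : option (option K)) m := ~ m <k a /\ match o with
  | None => agree a a d
  | Some None => forall x, x <k a -> tb d x = Some (e m x)
  | Some (Some c) => c <k a /\ agree c c d /\ tb d c = None /\
      forall x, c <k x -> x <k a -> tb d x = Some (e m x)
  end.
have ex (d : K) : exists om, ~ d <k a -> Rep d (fst om) (snd om).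
{ case: (classic (d <k a)) => [?|da]; first by exists (None, d).
  case: (classic (d = a \/ tri a d)) => [h|h].
    exists (None, a) => _; split; first exact: wo_irr woK _.
    by case: h => [->//|]; exact: agree_tri.
  have ad : a <k d by case: (wo_nlt woK _ _ da) h => // -> []; left.
  have [|m [[ma md] mmin]] := wo_least woK (fun m => ~ m <k a /\ (m = d \/ tri m d)).
    by exists d; split=> //; left.
  have am : a <k m.
    by case: (wo_nlt woK _ _ ma) => // e_; case: h; rewrite -e_; case: md; auto.
  have tS x : x <k a -> ~ tri x d -> (forall c, tri c d -> x <k c -> ~ c <k a) ->
      tb d x = Some (e m x).
  { move=> xa nx xc; apply: tb_Some => //.
    - exact: (wo_trans woK) xa ad.
    - exact: (wo_trans woK) xa am.
    - by move=> c cd xc_ cm; apply: (mmin c) => //; split; [exact: xc|right]. }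
  have nad : ~ tri a d by move=> ?; apply: h; right.
  case: (last_predecessor d a ad nad) => [h'|[c [cd [ca cmax]]]].
  - exists (Some None, m) => _; split=> // x xa; apply: tS => //.
      by move=> /h'.
    by move=> c /h'.
  - exists (Some (Some c), m) => _; split=> //; split=> //; split; first exact: agree_tri.
    split; first by apply/tb_None.
    move=> x cx xa; apply: tS => //; first by move=> /cmax; apply.
    by move=> b bd xb; apply: cmax => //; apply: (wo_trans woK) cx xb. }
have [f fP] := dependent_choice_fun _ ex.
pose co (o : option (option K)) := match o with
  | None => pr m0 (pr m0 m0) | Some None => pr m0 (pr m1 m0) | Some (Some c) => pr m1 (idx a c) end.
pose g d := pr (co (fst (f d))) (code (snd (f d))).
have gP d d' : ~ d <k a -> ~ d' <k a -> g d = g d' -> agree a d d'.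
{ move=> /fP; rewrite /g; case: (f d) => [o m] /= [ma Ho] /fP.
  case: (f d') => [o' m'] /= [m'a Ho'] /prP [eo /(codeP _ _ ma m'a) em].
  have m10 : m1 <> m0 by auto.
  case: o Ho eo => [[c|]|]; case: o' Ho' => [[c'|]|] /= Ho' Ho /prP [e1 e2] //; last first.
  - by apply: agree_trans Ho'; apply: agree_sym.
  - by case/prP: e2.
  - by case/prP: e2.
  - by move=> x xa; rewrite Ho // Ho' // em.
  - case: Ho' Ho => [c'a [h1 [h2 h3]]] [ca [h1' [h2' h3']]].
    have ec := idxP _ _ _ ca c'a e2.
    subst c' => x xa; case: (wo_total woK x c) => [l|[->|l]].
    + by rewrite -h1 // h1'.
    + by rewrite h2 h2'.
    + by rewrite h3 // h3' // em. }
exists (fun u => g (del (proj1_sig u))) => -[u ua] [v va] /= h; apply: sig_eq => /=.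
have du := lev_del u; have dv := lev_del v; rewrite ua in du; rewrite va in dv.
by apply: node_eq; rewrite ua ?va //; apply: gP.
Qed.

(** A weakening common to kappa-branches and Souslin subtrees, so that one argument excludes
    both. *)
Definition narrow (R : node -> Prop) : Prop :=
  forall A : node -> Prop, (forall u, A u -> R u) -> antichain tlt A -> ~ inj_le K {u | A u}.

(* Nodes of [R] avoiding predecessors in [(a, b)] for all [b] follow the functions [e]
   there; since each [e m] takes every value fewer than [nu] times, they can be coloured
   by [nu] colours injectively on chains, so some colour class is a large antichain. *)
Lemma narrow_predecessors (R : node -> Prop) : narrow R ->
  forall a, exists b, forall u, R u -> b <k lev u -> exists x, tri x (del u) /\ a <k x /\ x <k b.
Proof.
move=> nR a; apply: NNPP => h.
(* A failure at [a] gives, for each [c], a node [r c] above level [c] whose branch has no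
   predecessors in [(a, c]]. *)
have exr c : exists u, R u /\ c <k lev u /\ forall x, tri x (del u) -> a <k x -> c <k x.
  have [b cb] := no_max _ _ Hnu Hnu_lt Hkappa c.
  apply: NNPP => h'; apply: h; exists b => u Ru bu; apply: NNPP => h''; apply: h'.
  exists u; split=> //; split; first exact: (wo_trans woK) cb bu.
  move=> x xu ax; apply: NNPP => cx; apply: h''; exists x; split=> //; split=> //.
  exact: (wo_le_lt_trans woK) cx cb.
have [r rP] := dependent_choice_fun _ exr.
have exm c : exists m, a <k c -> c <k m /\
    forall x, a <k x -> ~ c <k x -> tb (del (r c)) x = Some (e m x).
{ have [_ [l free]] := rP c.
  have cd : c <k del (r c) := wo_lt_le_trans woK _ _ _ l (lev_del _).
  have [cm [mP mmin]] := nxtP _ _ cd.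
  exists (nxt (del (r c)) c) => ac; split=> // x ax cx.
  apply: tb_Some => //.
  - by move=> /free /(_ ax).
  - exact: (wo_le_lt_trans woK) cx cd.
  - exact: (wo_le_lt_trans woK) cx cm.
  - move=> b bd xb; apply: mmin; last by right.
    by apply: free => //; apply: (wo_trans woK) ax xb. }
have [m mP] := dependent_choice_fun _ exm.
pose val c := e (m c) c.
pose prec c' c := a <k c' /\ c' <k c /\ val c' = val c /\
  forall x, ~ c' <k x -> tb (del (r c')) x = tb (del (r c)) x.
(* If [prec c' c], the two branches have the same entry at [c'], so [e (m c) c'] equals [val c];
   this holds for fewer than [nu] many [c'], and [col] can avoid their colours. *)
have sp c : a <k c -> small (N := N) (fun c' => prec c' c).
  move=> ac; apply: small_sub (e_small (m c) (val c)) => c' [ac' [c'c [v' h']]].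
  have [cm hc] := mP c ac; have [c'm hc'] := mP c' ac'.
  split; first exact: (wo_trans woK) c'c cm.
  have := h' c' (wo_irr woK c').
  rewrite hc' //; first exact: (wo_irr woK).
  rewrite hc //; first by move=> /(wo_trans woK _ _ _ c'c)/(wo_irr woK).
  by case=> <-; rewrite -/(val c') v'; exact: (wo_irr woN).
have [n0 _] := two_below ltN Hnu.
have [col colP] := wo_choice woK n0
  (fun c f v => a <k c -> forall c', prec c' c -> f c' <> v)
  ltac:(by move=> c f g v fg h' ac c' pc; rewrite -fg; [case: pc => _ []|exact: h'])
  ltac:(by move=> c f _; case: (classic (a <k c)) => ac;
        [have [v vP] := small_fresh _ f (sp c ac); exists v|exists n0]).
have [pr prP] := pairing ltN Hnu Hnu_lt.
have [n nP] := unbounded_fiber _ _ Hnu Hnu_lt Hkappa (fun c => pr (val c) (col c)).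
have [z [zY zi]] := increasing_in_unbounded _ _ Hnu Hnu_lt Hkappa
  (fun c => pr (val c) (col c) = n /\ a <k c)
  ltac:(by move=> b; have [d [da db]] := wo_ub2 woK a b; have [c [cn dc]] := nP d;
        exists c; split; [split=> //; exact: (wo_le_lt_trans woK _ _ _ da dc)|];
        exact: (wo_le_lt_trans woK _ _ _ db dc)).
(* Within one colour class, agreement up to and including [z k] would make [z k] precede [z l],
   against the colouring. Both nodes have level above [z k], so they are incomparable. *)
have key k l : z k <k z l ->
    ~ forall x, ~ z k <k x -> tb (del (r (z k))) x = tb (del (r (z l))) x.
  move=> kl ag; have [ek ak] := zY k; have [el al] := zY l.
  have [ev ec] : val (z k) = val (z l) /\ col (z k) = col (z l) by apply: prP; rewrite ek el.
  by apply: (colP (z l) al (z k)).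
have inc k l : z k <k z l -> ~ tlt (r (z k)) (r (z l)) /\ ~ tlt (r (z l)) (r (z k)).
  move=> kl; have [_ [lk _]] := rP (z k); have [_ [ll _]] := rP (z l).
  split=> -[_ ag]; apply: (key k l kl) => x zx.
    by apply: ag; apply: (wo_le_lt_trans woK) zx lk.
  symmetry; apply: ag; apply: (wo_le_lt_trans woK) zx _; exact: (wo_trans woK) kl ll.
apply: (nR (fun u => exists k, u = r (z k))).
- by move=> u [k ->]; case: (rP (z k)).
- move=> u v [k ->] [l ->] d; case: (wo_total woK (z k) (z l)) => [kl|[kl|lk]].
  + exact: inc.
  + by case: d; rewrite kl.
  + by have [? ?] := inc _ _ lk.
- exists (fun k => exist (fun u => exists k, u = r (z k)) (r (z k)) (ex_intro _ k eq_refl)).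
  move=> k l [] rkl; apply: (increasing_inj _ _ Hkappa z zi).
  by apply: (wo_antisym woK) => kl; apply: (key _ _ kl); rewrite rkl.
Qed.

(** At a closure point [d] of the bounds [g], every node of [R] above level [d] has predecessors
    cofinal in [d], hence passes through [d] by closedness. Two closure points below one such node
    are comparable. *)
Lemma kappa_chain_of_narrow (R : node -> Prop) :
  (forall a, exists u, R u /\ a <k lev u) -> narrow R ->
  exists y : K -> K, forall a b, a <k b -> tri (y a) (y b).
Proof.
move=> Ru /narrow_predecessors nR.
have [g gP] := dependent_choice_fun _ nR.
(* The first clause excludes the least point of [K], since [tri_closed] asks for a predecessor below
   the limit. *)
pose Y d := (exists a, a <k d) /\ forall x, x <k d -> g x <k d.
have [|y [yY yi]] := increasing_in_unbounded _ _ Hnu Hnu_lt Hkappa Y.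
  move=> a; have [d [ad dP]] := closure_point _ _ Hnu Hnu_lt Hkappa g a.
  by exists d; split=> //; split=> //; exists a.
have pass d u : Y d -> R u -> d <k lev u -> tri d (del u).
  move=> [[a ad] dg] uR du.
  have h x : x <k d -> exists z, tri z (del u) /\ x <k z /\ z <k d.
    move=> xd; have [z [zu [xz zg]]] := gP x u uR (wo_trans woK _ _ _ (dg x xd) du).
    by exists z; split=> //; split=> //; apply: (wo_trans woK) zg (dg x xd).
  apply: tri_closed => //; first exact: (wo_lt_le_trans woK) du (lev_del _).
  by have [z [zu [_ zd]]] := h a ad; exists z.
exists y => a b ab; have [u [uR bu]] := Ru (y b).
have ub := pass _ _ (yY b) uR bu.
apply/(tri_coh _ _ ub); first exact: yi.
by apply: pass => //; apply: (wo_trans woK) (yi _ _ ab) bu.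
Qed.

(** A kappa-branch and a Souslin subtree of the thin tree are both unbounded and [narrow], so
    without a long chain for [tri] the hypothesis specializes the tree. *)
Lemma tri_chain_or_special
  (Htrees : forall (T : Type) (lt : T -> T -> Prop),
      aronszajn ltK lt -> ~ has_souslin_subtree ltK lt -> special ltN lt) :
  (exists y : K -> K, forall a b, a <k b -> tri (y a) (y b)) \/
  exists s : K -> N, forall c d, tri c d -> s c <> s d.
Proof.
case: (classic (exists y : K -> K, forall a b, a <k b -> tri (y a) (y b))) => [|ny]; first by left.
right; have [] := Htrees node tlt.
{ split; first exact: tree_tlt.
  split.
  { move=> [C [Cch [f [[fi fs] fo]]]]; apply: ny; apply: (kappa_chain_of_narrow C).
      move=> a; have [b ab] := no_max _ _ Hnu Hnu_lt Hkappa a.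
      have [g gP] := dependent_choice_fun _ fs.
      exists (proj1_sig (g b)); split; first exact: proj2_sig.
      apply: (wo_lt_le_trans woK) ab _.
      apply: (increasing_ge woK (fun x => lev (proj1_sig (g x))) (fun _ => True)) => // x y _ xy.
      by have [] : tlt (proj1_sig (g x)) (proj1_sig (g y)) by apply/fo; rewrite !gP.
    move=> A AC anti [k ki].
    have [_ [[j _] _]] := Hkappa; have [n0 _] := two_below ltN Hnu.
    have [c dc] := no_max _ _ Hnu Hnu_lt Hkappa (j n0).
    have d : proj1_sig (k (j n0)) <> proj1_sig (k c).
      by move=> /sig_eq/ki h; apply: (wo_irr woK c); rewrite -{1}h.
    have [h1 h2] := anti _ _ (proj2_sig (k (j n0))) (proj2_sig (k c)) d.
    by case: (Cch _ _ (AC _ (proj2_sig (k (j n0)))) (AC _ (proj2_sig (k c)))) => [|[]]. }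
  move=> a h; apply: (succ_not_inj _ _ Hkappa); apply: inj_le_trans h _.
  apply: inj_le_trans _ (thin_levels a).
  exists (fun t => exist (fun u => lev u = a) (proj1_sig t)
    (on_level_unique _ _ (proj2_sig t))) => t t' [].
  exact: sig_eq. }
{ move=> [S [[[_ [_ [_ [_ Slev]]]] [_ _]] Santi]].
  apply: ny; apply: (kappa_chain_of_narrow S).
    move=> a; have [b ab] := no_max _ _ Hnu Hnu_lt Hkappa a.
    have [u ub] := Slev b; exists (proj1_sig u); split; first exact: proj2_sig.
    exact: (wo_lt_le_trans woK) ab (on_level_le S u b ub).
  move=> A AS anti kA; apply: (Santi (fun x => A (proj1_sig x))).
    by move=> x y Ax Ay xy; apply: anti => // /sig_eq.
  apply: inj_le_trans kA _.
  exists (fun u => exist (fun x : {t | S t} => A (proj1_sig x))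
    (exist _ (proj1_sig u) (AS _ (proj2_sig u))) (proj2_sig u)) => u v [].
  exact: sig_eq. }
move=> s sP.
(* Sending [c] to the node of level [c] on its own branch carries [tri] into the tree order. *)
have ex c : exists u, lev u = c /\ agree c (del u) c by apply: node_ex; exact: (wo_irr woK).
have [g gP] := dependent_choice_fun _ ex.
exists (fun c => s (g c)) => c d cd.
have [lc ac] := gP c; have [ld ad] := gP d.
have gcd : tlt (g c) (g d).
  split; first by rewrite lc ld; exact: tri_lt.
  rewrite lc; apply: agree_trans ac _; apply: agree_trans (agree_tri _ _ cd) _.
  apply: agree_sym; apply: agree_le ad => /(wo_trans woK _ _ _ (tri_lt _ _ cd)).
  exact: (wo_irr woK).
move=> e_s; apply: (tlt_irr (g d)).
suff h : g c = g d by rewrite h in gcd.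
apply: (sP (fun u => u = g c \/ u = g d)) => //; [|by left|by right].
by move=> u v [->|->] [->|->]; auto.
Qed.

End ThinTree.

(** * Coding and generic sequences *)

Section Coding.
Context {N K : Type} {ltN : N -> N -> Prop} {ltK : K -> K -> Prop}
  (Hnu : infinite_cardinal ltN)
  (Hnu_lt : equipotent { a : N & (seg ltN a -> N) } N)
  (Hkappa : successor_cardinal_of ltN ltK)
  (Hkappa2 : equipotent (N -> bool) K).

Notation "x <n y" := (ltN x y) (at level 70).
Notation "x <k y" := (ltK x y) (at level 70).

Let woK : well_order ltK := succ_wo _ _ Hkappa.

(** Indexing the segment below [d] turns its subsets into subsets of [N], and [2 ^ nu = kappa] codes
    these by points of [K]. *)
Lemma bounded_set_coding : exists dec : K -> K -> K -> Prop,
  forall (d : K) (P : K -> Prop), exists k, forall c, c <k d -> (dec d k c <-> P c).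
Proof.
have [idx idxP] := seg_indexing _ _ Hnu Hkappa.
have [F [Fi _]] := Hkappa2.
exists (fun d k c => exists u, F u = k /\ u (idx d c) = true) => d P.
pose u n := if excluded_middle_informative (exists c, c <k d /\ P c /\ idx d c = n)
  then true else false.
exists (F u) => c cd; split.
- move=> [v [/Fi ->]]; rewrite /u; case: excluded_middle_informative => // -[b [bd [Pb ib]]] _.
  by rewrite -(idxP d b c).
- move=> Pc; exists u; split=> //; rewrite /u; case: excluded_middle_informative => // h.
  by case: h; exists c.
Qed.

Lemma nowhere_dense_avoid (Nd : (K -> K) -> Prop) : nowhere_dense ltK Nd ->
  forall (x : K -> K) (a : K), exists (y : K -> K) (b : K), a <k b /\
    (forall c, c <k a -> y c = x c) /\ forall z, (forall c, c <k b -> z c = y c) -> ~ Nd z.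
Proof.
move=> nNd x a; apply: NNPP => h.
pose U y := forall c, c <k a -> y c = x c.
apply: (nNd U _ _ x) => //.
- move=> y Uy; exists a, (fun i => y (proj1_sig i)); split=> // z zy c ca.
  by have := zy (exist _ c ca) => /= ->; apply: Uy.
- move=> y Uy b s ys; apply: NNPP => h'; apply: h.
  have [c [ca cb]] := wo_ub2 woK a b; have [d cd] := no_max _ _ Hnu Hnu_lt Hkappa c.
  exists y, d; split; first exact: (wo_le_lt_trans woK) ca cd.
  split=> // z zy Nz; apply: h'; exists z; split=> // -[i ib] /=.
  rewrite zy; last exact: (ys (exist _ i ib)).
  by apply: (wo_trans woK) ib _; apply: (wo_le_lt_trans woK) cb cd.
Qed.

(* [al j] is the position reached before the [j]-th nowhere dense set is avoided, by
   fixing [x] up to [be j]; at [al j] the value of [x] is prescribed by [V]. *)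
Lemma generic_sequence (Nd : K -> (K -> K) -> Prop) (V : K -> (K -> Prop) -> K)
    (x0 : K -> K) (a0 : K) :
  (forall j, nowhere_dense ltK (Nd j)) ->
  exists (x al be : K -> K),
    (forall c, c <k a0 -> x c = x0 c) /\ (forall j, ~ Nd j x) /\
    (forall j, ~ al j <k a0) /\ (forall j, al j <k be j) /\
    (forall k j, k <k j -> ~ al j <k be k) /\
    (forall j b, ~ b <k a0 -> (forall k, k <k j -> ~ b <k be k) -> ~ b <k al j) /\
    (forall j, x (al j) = V (al j) (fun c => exists k, k <k j /\ c = al k)).
Proof.
move=> nNd.
pose al_ (f : K -> K * K * (K -> K)) k := fst (fst (f k)).
pose be_ (f : K -> K * K * (K -> K)) k := snd (fst (f k)).
(* A stage consists of a position [a], a length [b] and a function [y] of which the part below [b]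
   is kept. Leastness of [a] makes the positions continuous at limits. *)
pose R j f (v : K * K * (K -> K)) := let: (a, b, y) := v in
  ~ a <k a0 /\ (forall k, k <k j -> ~ a <k be_ f k) /\
  (forall b', ~ b' <k a0 -> (forall k, k <k j -> ~ b' <k be_ f k) -> ~ b' <k a) /\
  a <k b /\ (forall c, c <k a0 -> y c = x0 c) /\
  (forall k c, k <k j -> c <k be_ f k -> y c = snd (f k) c) /\
  y a = V a (fun c => exists k, k <k j /\ c = al_ f k) /\
  forall z, (forall c, c <k b -> z c = y c) -> ~ Nd j z.
have [||F FP] := wo_choice woK (a0, a0, x0) R.
{ move=> j f g [[a b] y] fg.
  have -> : (R j f (a, b, y)) = (R j g (a, b, y)) => //.
  have E : (fun c => exists k, k <k j /\ c = al_ f k) = (fun c => exists k, k <k j /\ c = al_ g k).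
    apply: functional_extensionality => c; apply: propositional_extensionality.
    by split=> -[k [kj ->]]; exists k; rewrite /al_ fg.
  have El P : (forall k, k <k j -> P (f k)) <-> (forall k, k <k j -> P (g k)).
    by split=> h k kj; move: (h k kj); rewrite fg.
  rewrite /R E; apply: propositional_extensionality.
  have E1 (b' : K) := El (fun v => ~ b' <k snd (fst v)).
  have E2 := El (fun v => forall c, c <k snd (fst v) -> y c = snd v c).
  split=> -[h1 [h2 [h3 [h4 [h5 [h6 [h7 h8]]]]]]]; 
    refine (conj h1 (conj _ (conj _ (conj h4 (conj h5 (conj _ (conj h7 h8))))))).
  - by apply/E1.
  - by move=> b' b'0 /E1; apply: h3.
  - by move=> k c kj; move: k kj c; apply/E2 => k kj c; apply: h6.
  - by apply/E1.
  - by move=> b' b'0 /E1; apply: h3.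
  - by move=> k c kj; move: k kj c; apply/E2 => k kj c; apply: h6. }
{ move=> j f Rf.
  have [a [[a1 a2] amin]] : exists a, (~ a <k a0 /\ forall k, k <k j -> ~ a <k be_ f k) /\
      forall b, ~ b <k a0 /\ (forall k, k <k j -> ~ b <k be_ f k) -> ~ b <k a.
    have [b bP] := bounded_below_seg _ _ Hnu Hnu_lt Hkappa j (be_ f).
    have [c [ca cb]] := wo_ub2 woK a0 b.
    apply: (wo_least woK); exists c; split=> // k kj ck.
    by apply: (wo_irr woK c); apply: (wo_trans woK) ck _; apply: (wo_lt_le_trans woK) (bP _ kj) cb.
  have coh k l c : k <k j -> l <k j -> c <k be_ f k -> c <k be_ f l -> snd (f k) c = snd (f l) c.
    have half k' l' : k' <k l' -> l' <k j -> c <k be_ f k' -> snd (f k') c = snd (f l') c.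
      move=> kl lj ck; move: (Rf _ lj); rewrite /R; case: (f l') => [[al bl] yl].
      by move=> [_ [_ [_ [_ [_ [h _]]]]]]; rewrite /= (h k').
    move=> kj lj ck cl; case: (wo_total woK k l) => [kl|[->//|lk]]; first exact: half.
    by symmetry; apply: half.
  have base k c : k <k j -> c <k a0 -> snd (f k) c = x0 c /\ c <k be_ f k.
    move=> kj ca; move: (Rf _ kj); rewrite /R /be_; case: (f k) => [[ak bk] yk] /=.
    move=> [h1 [_ [_ [h4 [h5 _]]]]]; split; first exact: h5.
    by apply: (wo_trans woK) h4; apply: (wo_lt_le_trans woK) ca h1.
  (* [g] glues the earlier approximations, takes the prescribed value at [a], which all earlier
     lengths leave free, and follows [x0] elsewhere. *)
  have exg c : exists v, (forall k, k <k j -> c <k be_ f k -> v = snd (f k) c) /\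
      (c <k a0 -> v = x0 c) /\
      (c = a -> v = V a (fun c => exists k, k <k j /\ c = al_ f k)).
    case: (classic (c = a)) => [->|ca].
      exists (V a (fun c => exists k, k <k j /\ c = al_ f k)); split; last split=> //.
      by move=> k kj ak; case: (a2 k kj).
    case: (classic (exists k, k <k j /\ c <k be_ f k)) => [[k [kj ck]]|h].
      exists (snd (f k) c); split; first by move=> l lj cl; apply: coh.
      by split=> // ca0; case: (base k c kj ca0).
    by exists (x0 c); split=> // k kj ck; case: h; exists k.
  have [g gP] := dependent_choice_fun _ exg.
  (* Starting the avoidance of [Nd j] at [a'], past [a], keeps the value prescribed at [a]. *)
  have [a' aa'] := no_max _ _ Hnu Hnu_lt Hkappa a.
  have [y [b [a'b [yg yN]]]] := nowhere_dense_avoid _ (nNd j) g a'.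
  have {}yg c : ~ a <k c -> y c = g c by move=> ac; apply: yg; apply: (wo_le_lt_trans woK) ac aa'.
  have irr c : c <k a -> ~ a <k c by move=> h /(wo_trans woK _ _ _ h)/(wo_irr woK).
  exists (a, b, y); split=> //; split=> //; split; first by move=> b' h1 h2; apply: amin.
  split; first exact: (wo_trans woK) aa' a'b.
  split.
    move=> c ca; rewrite yg; last exact: (proj1 (proj2 (gP c))).
    by apply: irr; apply: (wo_lt_le_trans woK) ca a1.
  split.
    move=> k c kj ck; rewrite yg; last exact: (proj1 (gP c)).
    by apply: irr; apply: (wo_lt_le_trans woK) ck (a2 _ kj).
  by split=> //; rewrite yg; [apply: (wo_irr woK)|apply: (proj2 (proj2 (gP a)))]. }
pose al := al_ F; pose be := be_ F.
have FS j : ~ al j <k a0 /\ (forall k, k <k j -> ~ al j <k be k) /\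
  (forall b', ~ b' <k a0 -> (forall k, k <k j -> ~ b' <k be k) -> ~ b' <k al j) /\
  al j <k be j /\ (forall c, c <k a0 -> snd (F j) c = x0 c) /\
  (forall k c, k <k j -> c <k be k -> snd (F j) c = snd (F k) c) /\
  snd (F j) (al j) = V (al j) (fun c => exists k, k <k j /\ c = al k) /\
  forall z, (forall c, c <k be j -> z c = snd (F j) c) -> ~ Nd j z.
  by move: (FP j); rewrite /R /al /be /al_ /be_; case: (F j) => [[? ?] ?].
have al_mono k j : k <k j -> al k <k al j.
  move=> kj; have [_ [h _]] := FS j; have [_ [_ [_ [h' _]]]] := FS k.
  exact: (wo_lt_le_trans woK) h' (h k kj).
have be_ge j : ~ be j <k j.
  apply: (wo_le_trans woK _ (al j)).
    by apply: (increasing_ge woK al (fun _ => True)) => // k l _; apply: al_mono.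
  move=> l; have [_ [_ [_ [h _]]]] := FS j.
  by apply: (wo_irr woK (be j)); apply: (wo_trans woK) l h.
have exj c : exists j, c <k be j.
  have [j cj] := no_max _ _ Hnu Hnu_lt Hkappa c.
  by exists j; apply: (wo_lt_le_trans woK) cj (be_ge j).
have [j jP] := dependent_choice_fun _ exj.
pose x c := snd (F (j c)) c.
have xE k c : c <k be k -> x c = snd (F k) c.
  move=> ck; rewrite /x; case: (wo_total woK (j c) k) => [l|[->//|l]].
    by have [_ [_ [_ [_ [_ [h _]]]]]] := FS k; rewrite (h (j c)).
  by have [_ [_ [_ [_ [_ [h _]]]]]] := FS (j c); rewrite (h k).
exists x, al, be; split.
  by move=> c ca; have [_ [_ [_ [_ [h _]]]]] := FS (j c); rewrite /x h.
split; first by move=> k; have [_ [_ [_ [_ [_ [_ [_ h]]]]]]] := FS k; apply: h => c; apply: xE.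
split; first by move=> k; case: (FS k).
split; first by move=> k; case: (FS k) => _ [_ [_ []]].
split; first by move=> k l kl; case: (FS l) => _ [h _]; apply: h.
split; first by move=> k; case: (FS k) => _ [_ []].
move=> k; have [_ [_ [_ [h [_ [_ [<- _]]]]]]] := FS k.
exact: xE.
Qed.

End Coding.

(** * The set of codes of orders with a long chain *)

Section CodedOrder.
Context {K : Type} {ltK : K -> K -> Prop} (woK : well_order ltK) (dec : K -> K -> K -> Prop).

Notation "x <k y" := (ltK x y) (at level 70).

(* If the set coded by [x d] is not closed or not coherent, [d] becomes a root; so every
   [x] codes an order, and no choice of [x] below [d] prevents a chain from continuing. *)
Definition dset (x : K -> K) (d c : K) : Prop := c <k d /\ dec d (x d) c.

Definition coherent_at (x : K -> K) (d : K) : Prop :=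
  (forall c, c <k d -> (exists b, dset x d b /\ b <k c) ->
     (forall a, a <k c -> exists b, dset x d b /\ a <k b /\ b <k c) -> dset x d c) /\
  (forall c, dset x d c -> forall b, b <k c -> (dset x c b <-> dset x d b)).

Definition coded_lt (x : K -> K) (c d : K) : Prop := dset x d c /\ coherent_at x d.

Lemma coded_lt_lt x c d : coded_lt x c d -> c <k d.
Proof. by case=> [[]]. Qed.

(** The set coded at [c] is the part below [c] of the set coded at [d], so both conditions pass down
    and [c] is not reset to a root. *)
Lemma coherent_below x c d : coded_lt x c d -> coherent_at x c.
Proof.
move=> [cd [cl co]]; have l : c <k d by case: cd.
split=> [b bc [a [ac ab]] lim|b bc a ab].
- apply/(co c cd) => //; apply: cl; first exact: (wo_trans woK) bc l.
    by exists a; split=> //; apply/(co c cd) => //; apply: (wo_trans woK) ab bc.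
  move=> a' a'b; have [z [zc [az zb]]] := lim a' a'b; exists z; split=> //.
  by apply/(co c cd) => //; apply: (wo_trans woK) zb bc.
- have bc' : b <k c by case: bc.
  have bd : dset x d b by apply/(co c cd).
  have ac := wo_trans woK _ _ _ ab bc'.
  by split=> [/(co b bd _ ab)/(co c cd _ ac)|/(co c cd _ ac)/(co b bd _ ab)].
Qed.

Lemma coded_lt_coh x c d : coded_lt x c d ->
  forall b, b <k c -> (coded_lt x b c <-> coded_lt x b d).
Proof.
move=> cd b bc; have gc := coherent_below _ _ _ cd; case: cd => cd gd.
by split=> -[h _]; split=> //; apply/(proj2 gd _ cd).
Qed.

Lemma coded_lt_closed x d c : c <k d -> (exists b, coded_lt x b d /\ b <k c) ->
  (forall a, a <k c -> exists b, coded_lt x b d /\ a <k b /\ b <k c) -> coded_lt x c d.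
Proof.
move=> cd [b [[bd gd] bc]] lim; split=> //; apply: (proj1 gd) => //; first by exists b.
by move=> a /lim [z [[zd _] zz]]; exists z.
Qed.

(** The relation at [d] reads [x] only at [d] and below; this makes both its truth and its failure
    open conditions. *)
Lemma coded_lt_local x y c d : (forall b, ~ d <k b -> x b = y b) ->
  coded_lt x c d -> coded_lt y c d.
Proof.
move=> xy.
have D b a : ~ d <k b -> (dset x b a <-> dset y b a) by move=> /xy; rewrite /dset => ->.
have Dd a := D d a (wo_irr woK d).
have Dc b a : b <k d -> (dset x b a <-> dset y b a).
  by move=> bd; apply: D => /(wo_trans woK _ _ _ bd)/(wo_irr woK).
rewrite /coded_lt /coherent_at => -[h0 [h1 h2]]; split; first by apply/Dd.
split=> [b bd [a [/Dd ad ab]] lim|b /Dd bd a ab].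
  apply/Dd; apply: h1 => //; first by exists a.
  by move=> a' /lim [z [/Dd zd zz]]; exists z.
have l : b <k d by case: bd.
by split=> [/(Dc _ _ l)/(h2 _ bd _ ab)/Dd|/Dd/(h2 _ bd _ ab)/(Dc _ _ l)].
Qed.

Definition has_chain (x : K -> K) : Prop :=
  exists y : K -> K, forall a b, a <k b -> coded_lt x (y a) (y b).

End CodedOrder.

(** * Definability of the set of codes *)

Section Definable.
Context {N K : Type} {ltN : N -> N -> Prop} {ltK : K -> K -> Prop}
  (Hnu : infinite_cardinal ltN)
  (Hnu_lt : equipotent { a : N & (seg ltN a -> N) } N)
  (Hkappa : successor_cardinal_of ltN ltK) (dec : K -> K -> K -> Prop).

Notation "x <n y" := (ltN x y) (at level 70).
Notation "x <k y" := (ltK x y) (at level 70).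

Let woK : well_order ltK := succ_wo _ _ Hkappa.
Notation tri := (coded_lt (ltK := ltK) dec).

Lemma kopen2_local (P : (K -> K) * (K -> K) -> Prop) :
  (forall p, P p -> exists a, forall q, (forall c, c <k a -> fst q c = fst p c) ->
     (forall c, c <k a -> snd q c = snd p c) -> P q) -> kopen2 ltK P.
Proof.
move=> h p /h [a aP]; exists a, (fun i => fst p (proj1_sig i)), a, (fun i => snd p (proj1_sig i)).
do 2!split=> //; move=> q q1 q2; apply: aP => c ca.
- exact: (q1 (exist _ c ca)).
- exact: (q2 (exist _ c ca)).
Qed.

(** A failure at [a] and [b] involves the second coordinate at these points and the first up to
    [snd p b], so it persists on a basic neighbourhood. *)
Lemma has_chain_sigma11 : sigma11 ltK (has_chain (ltK := ltK) dec).
Proof.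
exists (fun p => forall a b, a <k b -> tri (fst p) (snd p a) (snd p b)); split=> //.
apply: kopen2_local => p np.
have [a [b [ab nab]]] : exists a b, a <k b /\ ~ tri (fst p) (snd p a) (snd p b).
  apply: NNPP => h; apply: np => a b ab; apply: NNPP => nab; apply: h; by exists a, b.
have [c [cb cy]] := wo_ub2 woK b (snd p b); have [d cd] := no_max _ _ Hnu Hnu_lt Hkappa c.
have bd := wo_le_lt_trans woK _ _ _ cb cd.
exists d => q q1 q2 qC; apply: nab.
have loc v : ~ c <k v -> v <k d by move=> h; apply: (wo_le_lt_trans woK) h cd.
have ad := wo_trans woK _ _ _ ab bd.
have := qC a b ab; rewrite (q2 a ad) (q2 b bd); apply: (coded_lt_local woK).
by move=> e ye; apply: q1; apply: (wo_le_lt_trans woK) ye (loc _ cy).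
Qed.

(** A [sigma11] witness maps [K] to [K], so [lab] reads a colour in [N] off a point of [K]. *)
Lemma specializable_sigma11 (lab : K -> N) : sigma11 ltK (fun x =>
  exists y : K -> K, forall c d, tri x c d -> lab (y c) <> lab (y d)).
Proof.
exists (fun p => forall c d, tri (fst p) c d -> lab (snd p c) <> lab (snd p d)); split=> //.
apply: kopen2_local => p np.
have [c [d [cd ncd]]] : exists c d, tri (fst p) c d /\ lab (snd p c) = lab (snd p d).
  apply: NNPP => h; apply: np => c d cd e; apply: h; by exists c, d.
have [d' dd'] := no_max _ _ Hnu Hnu_lt Hkappa d.
exists d' => q q1 q2 qC; apply: (qC c d).
  apply: (coded_lt_local woK) cd => b bd.
  by symmetry; apply: q1; apply: (wo_le_lt_trans woK) bd dd'.
rewrite q2 ?q2 //; apply: (wo_trans woK) dd'; exact: coded_lt_lt cd.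
Qed.

Lemma has_chain_or_specializable
  (Htrees : forall (T : Type) (lt : T -> T -> Prop),
      aronszajn ltK lt -> ~ has_souslin_subtree ltK lt -> special ltN lt) (x : K -> K) :
  has_chain (ltK := ltK) dec x \/ exists s : K -> N, forall c d, tri x c d -> s c <> s d.
Proof.
have [e [e_small e_coh]] := coherent_functions Hnu Hnu_lt Hkappa.
have exn (p : K * K) : exists n, snd p <k fst p ->
    snd p <k n /\ (n = fst p \/ tri x n (fst p)) /\
    forall m, snd p <k m -> m = fst p \/ tri x m (fst p) -> ~ m <k n.
  case: p => d c /=; case: (classic (c <k d)) => [cd|?]; last by exists d.
  have [|n [[cn nd] nmin]] := wo_least woK (fun n => c <k n /\ (n = d \/ tri x n d)).
    by exists d; split=> //; left.
  by exists n => _; split=> //; split=> // m cm md; apply: nmin.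
have [nxt nxtP] := dependent_choice_fun _ exn.
exact: (tri_chain_or_special Hnu Hnu_lt Hkappa (tri x) (coded_lt_lt dec x)
  (coded_lt_coh woK dec x) (coded_lt_closed dec x) e e_small e_coh
  (fun d c => nxt (d, c)) (fun d c => nxtP (d, c)) Htrees).
Qed.

(** Specializing functions describe the complement: each [x] without a long chain has one, and along
    a long chain such a function would inject [K] into [N]. *)
Lemma has_chain_delta11
  (Htrees : forall (T : Type) (lt : T -> T -> Prop),
      aronszajn ltK lt -> ~ has_souslin_subtree ltK lt -> special ltN lt) :
  delta11 ltK (has_chain (ltK := ltK) dec).
Proof.
split; first exact: has_chain_sigma11.
have [_ [[j ji] _]] := Hkappa; have [n0 _] := two_below ltN Hnu.
pose lab k := epsilon (inhabits n0) (fun n => j n = k).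
have labP n : lab (j n) = n.
  by apply: ji; apply: (epsilon_spec (inhabits n0) (fun m => j m = j n)); exists n.
have [C [Cc CP]] := specializable_sigma11 lab.
exists C; split=> // x; rewrite -CP; split.
- move=> nc; case: (has_chain_or_specializable Htrees x) => // -[s sP].
  by exists (fun c => j (s c)) => c d cd; rewrite !labP; apply: sP.
- move=> [y yP] [z zP]; apply: (succ_not_inj _ _ Hkappa).
  exists (fun a => lab (y (z a))) => a b e.
  by apply: (wo_antisym woK) => ab; apply: (yP _ _ (zP _ _ ab)); rewrite e.
Qed.

(** * Failure of the kappa-Baire property *)

Context (decP : forall (d : K) (P : K -> Prop), exists k, forall c, c <k d -> (dec d k c <-> P c)).

(** For nonempty [U], prescribing the empty set makes every position a root, and the generic point
    of [U] has no long chain. For empty [U], prescribing the set of earlier positions turns the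
    positions into a long chain. Either point avoids every [Nd j], against the covering. *)
Lemma has_chain_not_baire : ~ baire_property ltK (has_chain (ltK := ltK) dec).
Proof.
move=> [U [Nd [Uo [nNd cover]]]].
have exV (p : K * (K -> Prop)) : exists k, forall c, c <k fst p -> (dec (fst p) k c <-> snd p c).
  exact: decP.
have [V VP] := dependent_choice_fun _ exV.
case: (classic (exists x, U x)) => [[x0 Ux0]|nU].
- have [a0 [s [xs sU]]] := Uo x0 Ux0.
  have [x [al [be [xx0 [xN [al0 [albe [beal [almin xal]]]]]]]]] :=
    generic_sequence Hnu Hnu_lt Hkappa Nd (fun a _ => V (a, fun _ => False)) x0 a0 nNd.
  have Ux : U x by apply: sU => -[c ca] /=; rewrite xx0 //; exact: (xs (exist _ c ca)).
  have empty j c : ~ tri x c (al j).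
    by move=> [[l]]; rewrite xal => /(VP (al j, fun _ => False) c l).
  have nx : ~ has_chain (ltK := ltK) dec x.
    move=> [y yP].
    have yi a b (ab : a <k b) : y a <k y b := coded_lt_lt dec x _ _ (yP a b ab).
    have exh a : exists b, be a <k b /\ y a <k b.
      have [c [cb cy]] := wo_ub2 woK (be a) (y a); have [d cd] := no_max _ _ Hnu Hnu_lt Hkappa c.
      by exists d; split; apply: (wo_le_lt_trans woK) cd.
    have [h hP] := dependent_choice_fun _ exh.
    have [d [a0d dP]] := closure_point _ _ Hnu Hnu_lt Hkappa h a0.
    have al_mono k l : k <k l -> al k <k al l.
      by move=> kl; apply: (wo_lt_le_trans woK) (albe k) (beal _ _ kl).
    have al_ge k : ~ al k <k k.
      by apply: (increasing_ge woK al (fun _ => True)) => // a b _; apply: al_mono.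
    have y_ge k : ~ y k <k k.
      by apply: (increasing_ge woK y (fun _ => True)) => // a b _; apply: yi.
    have be_d k : k <k d -> be k <k d.
      by move=> kd; apply: (wo_trans woK) (proj1 (hP k)) (dP k kd).
    have y_d k : k <k d -> y k <k d.
      by move=> kd; apply: (wo_trans woK) (proj2 (hP k)) (dP k kd).
    (* [d] lies above [a0] and is closed under [be], so the minimality of positions puts [al d] at
       [d]. *)
    have ald : al d = d.
      apply: (wo_antisym woK) (al_ge d) _; apply: almin.
        by move=> /(wo_trans woK _ _ _ a0d)/(wo_irr woK).
      by move=> k /be_d kd /(wo_trans woK _ _ _ kd)/(wo_irr woK).
    have [d' dd'] := no_max _ _ Hnu Hnu_lt Hkappa d.
    have below k : k <k d -> tri x (y k) (y d').
      by move=> kd; apply: yP; apply: (wo_trans woK) kd dd'.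
    (* The chain is cofinal in [d], so closedness puts [d] below [y d']; coherence then makes [y a0]
       a predecessor of the root [d]. *)
    have tdd' : tri x d (y d').
    { apply: (coded_lt_closed dec).
      + by apply: (wo_le_lt_trans woK) (y_ge d) (yi _ _ dd').
      + by exists (y a0); split; [apply: below|apply: y_d].
      + move=> a ad; exists (y (h a)); split; first exact: below (dP a ad).
        split; last exact: y_d (dP a ad).
        apply: (wo_lt_le_trans woK _ (h a)); last exact: y_ge.
        apply: (wo_trans woK) (proj1 (hP a)).
        by apply: (wo_le_lt_trans woK) (al_ge a) (albe a). }
    apply: (empty d (y a0)); rewrite ald.
    by apply/(coded_lt_coh woK dec x _ _ tdd'); [apply: y_d|apply: below].
  by have [j] := cover x (or_intror (conj Ux nx)); apply: xN.
- have [_ [[j0 _] _]] := Hkappa; have [n0 _] := two_below ltN Hnu.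
  have [x [al [be [_ [xN [al0 [albe [beal [almin xal]]]]]]]]] :=
    generic_sequence Hnu Hnu_lt Hkappa Nd (fun a P => V (a, P)) (fun c => c) (j0 n0) nNd.
  have al_mono k l : k <k l -> al k <k al l.
    by move=> kl; apply: (wo_lt_le_trans woK) (albe k) (beal _ _ kl).
  have al_anti k l : al k <k al l -> k <k l.
    move=> kl; case: (wo_total woK k l) => [//|[e|lk]]; move: kl.
      by rewrite e => /(wo_irr woK).
    by move=> /(wo_trans woK _ _ _ (al_mono _ _ lk))/(wo_irr woK).
  have D j c : dset (ltK := ltK) dec x (al j) c <-> exists k, k <k j /\ c = al k.
    rewrite /dset xal; split=> [[cj]|[k [kj ->]]].
      by move=> /(VP (al j, _) c cj).
    split; first exact: al_mono.
    by apply/(VP (al j, _) (al k) (al_mono _ _ kj)); exists k.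
  (* For closedness take the least [i] with [al i] not below [c]. For [l] below [i] the limit
     hypothesis finds a position between [al l] and [c], so [be l] is at most [c]; minimality of
     [al i] then gives [c = al i]. *)
  have good j : coherent_at (ltK := ltK) dec x (al j).
    split=> [c cj [b [/D [k [kj ->]] kc]] lim|c /D [k [kj ->]] b bk].
      have [|i [ic imin]] := wo_least woK (fun i => ~ al i <k c).
        by exists j => /(wo_trans woK _ _ _ cj)/(wo_irr woK).
      have ci : ~ c <k al i.
        apply: almin; first by move=> c0; apply: (al0 k); apply: (wo_trans woK) kc c0.
        move=> l li cl; have lc : al l <k c by apply: NNPP => h; apply: (imin l h).
        have [b' [/D [m [mj ->]] [lm mc]]] := lim _ lc.
        apply: (beal _ _ (al_anti _ _ lm)); exact: (wo_trans woK) mc cl.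
      have e := wo_antisym woK _ _ ci ic.
      by apply/D; exists i; split=> //; apply: al_anti; rewrite -e.
    split=> /D [l [lk e]]; apply/D; exists l; split=> //.
      exact: (wo_trans woK) lk kj.
    by apply: al_anti; rewrite -e.
  have cx : has_chain (ltK := ltK) dec x.
    by exists al => a b ab; split=> //; apply/D; exists a.
  by have [j] := cover x (or_introl (conj cx (fun Ux => nU (ex_intro _ x Ux)))); apply: xN.
Qed.

End Definable.

Theorem theorem1p10 (N : Type) (ltN : N -> N -> Prop) (K : Type) (ltK : K -> K -> Prop)
  (Hnu : infinite_cardinal ltN)
  (Hnu_lt : equipotent { a : N & (seg ltN a -> N) } N)
  (Hkappa : successor_cardinal_of ltN ltK)
  (Hkappa2 : equipotent (N -> bool) K)
  (Htrees : forall (T : Type) (lt : T -> T -> Prop),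
      aronszajn ltK lt -> ~ has_souslin_subtree ltK lt -> special ltN lt) :
  exists A : (K -> K) -> Prop, delta11 ltK A /\ ~ baire_property ltK A.
Proof.
have [dec decP] := bounded_set_coding Hnu Hkappa Hkappa2.
exists (has_chain (ltK := ltK) dec); split.
- exact: (has_chain_delta11 Hnu Hnu_lt Hkappa dec Htrees).
- exact: (has_chain_not_baire Hnu Hnu_lt Hkappa dec decP).
Qed.
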